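(* Let $D$ be an integral domain. Then $D[X]_A$ is a locally $v$-domain if and only if $D$ is a locally $v$-domain.
   Context: $X$ is an indeterminate over $D$, $A=\{f\in D[X]\mid f(0)=1\}$, and $D[X]_A$ is the localization at $A$. For an integral domain $E$ with quotient field $K$ and nonzero fractional ideal $I$, $I^{-1}=\{x\in K\mid xI\subseteq E\}$ and $I_v=(I^{-1})^{-1}$. $E$ is a $v$-domain if $(II^{-1})_v=E$ for every nonzero finitely generated ideal $I$ of $E$. $E$ is a locally $v$-domain if $E_P$ is a $v$-domain for every prime ideal $P$ of $E$. *)

(* Defs.v *)
From HB Require Import structures.
From mathcomp Require Import all_boot all_order all_algebra.
From mathcomp Require Export fraction.
Set Implicit Arguments. Unset Strict Implicit. Unset Printing Implicit Defensive.
Import Order.TTheory GRing.Theory Num.Theory.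
Local Open Scope ring_scope.

(* An integral domain E is represented as a subring (predicate) of its field of
   fractions K; all fractional-ideal notions are computed inside K. *)
Section Ideals.
Variable K : fieldType.
Implicit Types (E I J P : K -> Prop) (s : seq K).

Definition ideal_gen E s : K -> Prop := fun x =>
  exists r : seq K, size r = size s /\ (forall i, (i < size s)%N -> E r`_i) /\
    x = \sum_(i < size s) r`_i * s`_i.

Definition frac_inv E I : K -> Prop := fun x => forall a, I a -> E (x * a).

Definition v_op E I : K -> Prop := frac_inv E (frac_inv E I).

Definition ideal_mul I J : K -> Prop := fun x =>
  exists a b : seq K, size a = size b /\
    (forall i, (i < size a)%N -> I a`_i /\ J b`_i) /\
    x = \sum_(i < size a) a`_i * b`_i.

Definition is_v_domain E : Prop :=
  forall s, (forall i, (i < size s)%N -> E s`_i) ->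
    (exists i, (i < size s)%N /\ s`_i != 0) ->
    forall x, v_op E (ideal_mul (ideal_gen E s) (frac_inv E (ideal_gen E s))) x <-> E x.

Definition is_prime_ideal E P : Prop :=
  (forall x, P x -> E x) /\ P 0 /\
  (forall x y, P x -> P y -> P (x + y)) /\
  (forall r x, E r -> P x -> P (r * x)) /\
  ~ P 1 /\
  (forall x y, E x -> E y -> P (x * y) -> P x \/ P y).

Definition localize E P : K -> Prop := fun x =>
  exists a b, E a /\ E b /\ ~ P b /\ x = a / b.

Definition is_locally_v_domain E : Prop :=
  forall P, is_prime_ideal E P -> is_v_domain (localize E P).

End Ideals.

Definition base_ring (D : idomainType) : {fraction D} -> Prop :=
  fun x => exists d : D, x = tofrac d.

Definition polyA_loc (D : idomainType) : {fraction {poly D}} -> Prop :=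
  fun x => exists f g : {poly D}, g.[0] = 1 /\ x = tofrac f / tofrac g.

(* Main.v *)
Require Import Defs.
From HB Require Import structures.
From mathcomp Require Import all_boot all_order all_algebra fraction.
From mathcomp Require Import ring.
From Stdlib Require Import Classical.

Set Implicit Arguments.
Unset Strict Implicit.
Unset Printing Implicit Defensive.

Import GRing.Theory.
Local Open Scope ring_scope.

(* A domain V with field of fractions K is a v-domain iff, for every nonzero
   finitely generated I, the only x in K with x I^-1 contained in I^-1 are the
   elements of V.
   The localization of D[X]_A at a prime Q is V[X]_S, where V is the
   localization of D at the prime P lying under Q and S consists of the
   polynomials of D[X] outside Q; since D[X] P lies in Q, every member of S has
   a unit coefficient in V.
   If V is a v-domain, let I be generated by g h_1, ..., g h_n with h_1, ..., h_n
   coprime in K[X]. An x with x I^-1 contained in I^-1 has the form b / s with b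
   in K[X] and s in S, and Gauss's lemma for v-domains reduces the hypothesis on
   x to the same hypothesis on each coefficient of b and the content ideal of
   the h_i, so b is in V[X].
   Conversely, a prime P of D lies under P + X D[X]; for that prime, members of S
   have unit constant term, so V[X]_S meets K in V and the v-property descends. *)

(** * Fractions over a domain and extension of injective morphisms to them *)

Section FractionField.
Variable R : idomainType.

Lemma fraction_repr (x : {fraction R}) :
  x = tofrac \n_(repr x) / tofrac \d_(repr x).
Proof.
rewrite -{1}[x]reprK; move: (repr x) => r.
have d0 : tofrac \d_r != 0 by rewrite tofrac_eq0 denom_ratioP.
apply: (mulIf d0); rewrite divfK //.
unlock tofrac; rewrite -[_ * _]FracField.pi_mul; apply/eqmodP.
rewrite /= FracField.equivfE /FracField.mulf !numden_Ratio ?oner_eq0 ?mulr1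
  ?denom_ratioP //.
by rewrite mulrC.
Qed.

Lemma fraction_ratio (x : {fraction R}) :
  exists n d : R, d != 0 /\ x = tofrac n / tofrac d.
Proof.
exists \n_(repr x), \d_(repr x); split; first exact: denom_ratioP.
exact: fraction_repr.
Qed.

Lemma fraction_lift (F : fieldType) (f : {rmorphism R -> F}) :
  injective f -> exists g : {rmorphism {fraction R} -> F},
    forall d, g (tofrac d) = f d.
Proof.
move=> finj; have f_neq0 d : d != 0 -> f d != 0.
  by rewrite -(rmorph0 f) (inj_eq finj).
pose g (x : {fraction R}) := f \n_(repr x) / f \d_(repr x).
(* Independence of the representative: additivity and multiplicativity can then be checked on any
   convenient fraction. *)
have gE x n d : d != 0 -> x = tofrac n / tofrac d -> g x = f n / f d.
  move=> d0; rewrite [in LHS](fraction_repr x) /g.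
  move: (\n_(repr x)) (\d_(repr x)) (denom_ratioP (repr x)) => n' d' d'0.
  move/eqP; rewrite eqr_div ?tofrac_eq0 // -!tofracM tofrac_eq => /eqP e.
  by apply/eqP; rewrite eqr_div ?f_neq0 // -!rmorphM e.
have gB : zmod_morphism g.
  move=> x y; have [n [d [d0 ->]]] := fraction_ratio x.
  have [n' [d' [d'0 ->]]] := fraction_ratio y.
  have dd : d * d' != 0 by rewrite mulf_neq0.
  rewrite (gE (tofrac n / tofrac d) n d) // (gE (tofrac n' / tofrac d') n' d') //
    (gE _ (n * d' + - n' * d) (d * d')) //.
    by rewrite rmorphD !rmorphM rmorphN -addf_div ?f_neq0 ?mulNr.
  by rewrite tofracD !tofracM tofracN -addf_div ?tofrac_eq0 ?mulNr.
have gM : monoid_morphism g.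
  split; first by rewrite (gE _ 1 1) ?oner_eq0 ?rmorph1 ?divr1.
  move=> x y; have [n [d [d0 ->]]] := fraction_ratio x.
  have [n' [d' [d'0 ->]]] := fraction_ratio y.
  have dd : d * d' != 0 by rewrite mulf_neq0.
  rewrite (gE (tofrac n / tofrac d) n d) // (gE (tofrac n' / tofrac d') n' d') //
    (gE _ (n * n') (d * d')) //.
    by rewrite !rmorphM mulf_div.
  by rewrite !tofracM mulf_div.
pose gBm := GRing.isZmodMorphism.Build _ _ g gB.
pose gMm := GRing.isMonoidMorphism.Build _ _ g gM.
pose G : {rmorphism {fraction R} -> F} := HB.pack g gBm gMm.
exists G => d; rewrite /G /= (gE _ d 1) ?oner_eq0 ?rmorph1 ?divr1 //.
Qed.
End FractionField.

(** * v-domains through the colon of an inverse ideal *)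

Section VDomainCriterion.
Variable K : fieldType.
Implicit Types (V I J : K -> Prop) (s : seq K).

Definition subring V := [/\ V 1, forall x y, V x -> V y -> V (x - y)
  & forall x y, V x -> V y -> V (x * y)].

Definition has_fraction_field V :=
  forall x, exists d, [/\ d != 0, V d & V (d * x)].

(* The condition (I^-1 : I^-1) = V; unlike [is_v_domain], it does not ask the
   generators to lie in V, so that I can be rescaled freely. *)
Definition inv_colon_trivial V := forall s, has (fun a => a != 0) s ->
  forall x, (forall z, (forall a, a \in s -> V (z * a)) ->
                       forall a, a \in s -> V (x * z * a)) -> V x.

Section Subring.
Variable V : K -> Prop.
Hypothesis Vring : subring V.

Lemma subring1 : V 1. Proof. by case: Vring. Qed.
Lemma subringM x y : V x -> V y -> V (x * y). Proof. by case: Vring => _ _; apply. Qed.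
Lemma subringB x y : V x -> V y -> V (x - y). Proof. by case: Vring => _ H _; apply: H. Qed.
Lemma subring0 : V 0.
Proof. by rewrite -(subrr 1); apply: subringB; exact: subring1. Qed.
Lemma subringN x : V x -> V (- x).
Proof. by move=> Vx; rewrite -sub0r; apply: subringB => //; exact: subring0. Qed.
Lemma subringD x y : V x -> V y -> V (x + y).
Proof. by move=> Vx Vy; rewrite -[y]opprK; apply: subringB => //; apply: subringN. Qed.

Lemma subring_sum (T : Type) (r : seq T) (Q : pred T) (F : T -> K) :
  (forall i, Q i -> V (F i)) -> V (\sum_(i <- r | Q i) F i).
Proof. by move=> VF; elim/big_ind: _ => //; [exact: subring0 | exact: subringD]. Qed.

Lemma common_denominator s : has_fraction_field V ->
  exists d, [/\ d != 0, V d & forall a, a \in s -> V (d * a)].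
Proof.
move=> fracV; elim: s => [|a s [d [d0 Vd ds]]].
  by exists 1; rewrite oner_eq0; split => //; exact: subring1.
have [e [e0 Ve Vea]] := fracV a; exists (d * e); split.
- by rewrite mulf_neq0.
- exact: subringM.
move=> b; rewrite inE => /orP[/eqP -> | bs]; first by rewrite -mulrA; apply: subringM.
by rewrite mulrAC; apply: subringM => //; exact: ds.
Qed.

Lemma ideal_gen_mem s a : a \in s -> ideal_gen V s a.
Proof.
move=> /(nthP 0)[k ks <-].
exists (mkseq (fun i => (i == k)%:R) (size s)); rewrite size_mkseq; split=> //; split.
  by move=> i si; rewrite nth_mkseq //; case: (i == k); [exact: subring1 | exact: subring0].
rewrite (bigD1 (Ordinal ks)) //= nth_mkseq // eqxx mul1r big1 ?addr0 // => i ik.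
rewrite nth_mkseq // -val_eqE /= in ik *.
by rewrite (negPf ik) mul0r.
Qed.

Lemma ideal_mul_mem I J a b : I a -> J b -> ideal_mul I J (a * b).
Proof.
move=> Ia Jb; exists [:: a], [:: b]; split=> //; split; last by rewrite big_ord1.
by case.
Qed.

Lemma frac_inv_genP s y :
  frac_inv V (ideal_gen V s) y <-> forall a, a \in s -> V (y * a).
Proof.
split=> [H a /ideal_gen_mem/H // | H _ [r [sr [Vr ->]]]].
rewrite mulr_sumr; apply: subring_sum => i _; rewrite mulrCA; apply: subringM.
  by apply: Vr.
by apply: H; rewrite mem_nth.
Qed.

(** The identity (I I^-1)^-1 = (I^-1 : I^-1), tested on the generators of I only. *)
Lemma frac_inv_mulP s x :
  frac_inv V (ideal_mul (ideal_gen V s) (frac_inv V (ideal_gen V s))) x <->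
  forall z, (forall a, a \in s -> V (z * a)) -> forall a, a \in s -> V (x * z * a).
Proof.
split=> [H z /frac_inv_genP zs a /ideal_gen_mem as_|H _ [a [b [sab [ab ->]]]]].
  by rewrite -mulrA [z * a]mulrC; apply: H; apply: ideal_mul_mem.
rewrite mulr_sumr; apply: subring_sum => i _; have [Ia Jb] := ab _ (ltn_ord i).
have /frac_inv_genP : forall c, c \in s -> V (x * b`_i * c).
  by apply: H; apply/frac_inv_genP.
by rewrite [a`_i * _]mulrC mulrA; apply.
Qed.

(** For J = I I^-1, J_v = V exactly when J^-1 is contained in V: one direction uses that 1 is in
    J_v, the other that 1 is in J^-1. Scaling I leaves (I^-1 : I^-1) unchanged, so a common
    denominator moves fractional generators into V. *)
Lemma is_v_domain_iff : has_fraction_field V ->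
  is_v_domain V <-> inv_colon_trivial V.
Proof.
move=> fracV; split=> [vdV s /hasP[a0 a0s a00] x xs | vdV s Vs [k [ks sk0]] x].
  have [d [d0 Vd ds]] := common_denominator s fracV.
  pose t := map ( *%R d) s.
  have Vt i : (i < size t)%N -> V t`_i.
    by rewrite size_map => si; rewrite (nth_map 0) //; apply: ds; rewrite mem_nth.
  have t0 : exists i, (i < size t)%N /\ t`_i != 0.
    exists (index a0 s); rewrite size_map index_mem a0s (nth_map 0) ?index_mem //.
    by rewrite nth_index // mulf_neq0.
  have := (vdV t Vt t0 1).2 subring1 x; rewrite mul1r; apply.
  apply/frac_inv_mulP => z zt _ /mapP[a as_ ->].
  rewrite mulrA -(mulrA x); apply: xs => // b bs.
  by rewrite -mulrA; apply: zt; rewrite map_f.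
have s0 : has (fun a => a != 0) s by apply/hasP; exists s`_k => //; rewrite mem_nth.
split=> [Hx | Vx y /frac_inv_mulP/(vdV _ s0)]; last exact: subringM.
rewrite -[x]mulr1; apply: Hx; apply/frac_inv_mulP => z zs a as_.
by rewrite mul1r; apply: zs.
Qed.

End Subring.
End VDomainCriterion.

(** * Polynomials with coefficients in V and Gauss's lemma *)

Section PolynomialsOverV.
Variables (K : fieldType) (V : K -> Prop).
Hypothesis Vring : subring V.
Implicit Types (f g p q : {poly K}).

Definition poly_over p := forall i, V p`_i.

Lemma poly_overM p q : poly_over p -> poly_over q -> poly_over (p * q).
Proof. by move=> Vp Vq i; rewrite coefM; apply: subring_sum => // k _; apply: subringM. Qed.

Lemma poly_overB p q : poly_over p -> poly_over q -> poly_over (p - q).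
Proof. by move=> Vp Vq i; rewrite coefB; apply: subringB. Qed.

Lemma poly_overZ c p : V c -> poly_over p -> poly_over (c *: p).
Proof. by move=> Vc Vp i; rewrite coefZ; apply: subringM. Qed.

(* Gauss's lemma for v-domains. With b the coefficient of X^m in g, descending
   induction on i shows that f_i b multiplies (f)^-1 into itself, so f_i b is in
   V and the term b X^m can be removed from g. *)
Lemma gauss_lemma f g : inv_colon_trivial V -> f != 0 -> poly_over (f * g) ->
  forall i j, V (f`_i * g`_j).
Proof.
move=> critV f0; have [m] := ubnPleq (size g).
elim: m g => [g gm _ i j | m IHm g gm Vfg].
  by rewrite (nth_default _ (leq_trans gm (leq0n j))) mulr0; apply: subring0.
set b := g`_m.
have g_big j : (m < j)%N -> g`_j = 0.
  by move=> mj; rewrite nth_default //; apply: leq_trans mj.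
pose g' := take_poly m g.
have gE : g = g' + b *: 'X^m.
  apply/polyP => j; rewrite coefD coef_take_poly coefZ coefXn.
  case: ltngtP => [jm|mj|->]; rewrite ?mulr0 ?mulr1 ?addr0 ?add0r //.
  exact: g_big.
have size_g' : (size g' <= m)%N by exact: size_take_poly.
have fg'E c : f * (c *: g') = c *: (f * g) - (c * b) *: (f * 'X^m).
  by rewrite [in RHS]gE mulrDr scalerDr -!scalerAr scalerA addrK.
(* Here z ranges over (f)^-1. The descent on i is an induction on [n]; at [n = 0] the index i is
   past the degree and f_i = 0. *)
have key n i l z : (size f <= i + n)%N -> (forall k, V (z * f`_k)) ->
    V (z * f`_l * (f`_i * b)).
  elim: n i l => [|n IHn] i l.
    by rewrite addn0 => fi _; rewrite (nth_default _ fi) mul0r mulr0; apply: subring0.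
  move=> fi Vz.
  (* The coefficient of X^(i+m) in f g is f_i b + S, where S collects f_k g_(i+m-k) for k != i.
     Terms with k < i vanish, as their index in g exceeds m. *)
  have := Vfg (i + m)%N; rewrite coefM.
  have im : (i < (i + m).+1)%N by rewrite ltnS leq_addr.
  rewrite (bigD1 (Ordinal im)) //= addKn -/b.
  set S := \sum_(_ < _ | _) _ => VS.
  have -> : z * f`_l * (f`_i * b) = z * f`_l * (f`_i * b + S) - z * f`_l * S by ring.
  apply: subringB => //; first exact: subringM.
  rewrite /S mulr_sumr; apply: subring_sum => // k; rewrite -val_eqE /= => ki.
  case: (ltngtP k i) ki => // [ki|ik] _.
    by rewrite g_big; [rewrite !mulr0; exact: subring0 | rewrite ltn_subRL ltn_add2r].
  have jm : (i + m - k < m)%N.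
    by have := ltn_ord k; rewrite ltnS => km; rewrite ltn_subLR // ltn_add2r.
  (* For k > i the inner induction puts z f_k b f in V[X], so removing the top term of g keeps z f_k
     f g' in V[X]. The outer induction, applied to z f_k g', then bounds the term. *)
  have Vw : poly_over (f * ((z * f`_k) *: g')).
    rewrite fg'E; apply: poly_overB; first exact: poly_overZ.
    move=> e; rewrite coefZ coefMXn; case: ifP => _; first by rewrite mulr0; exact: subring0.
    have -> : z * f`_k * b * f`_(e - m) = z * f`_(e - m) * (f`_k * b) by ring.
    by apply: IHn => //; apply: leq_trans fi _; rewrite addnS ltn_add2r.
  have size_w : (size ((z * f`_k) *: g') <= m)%N.
    exact: leq_trans (size_scale_leq _ _) size_g'.
  have := IHm _ size_w Vw l (i + m - k)%N.
  rewrite coefZ coef_take_poly jm; congr V; ring.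
have Vb i : V (f`_i * b).
  apply: (critV f).
    apply/hasP; exists (lead_coef f); last by rewrite lead_coef_eq0.
    by rewrite lead_coefE mem_nth // prednK // size_poly_gt0.
  move=> z zf _ /(nthP 0)[l lf <-].
  have -> : f`_i * b * z * f`_l = z * f`_l * (f`_i * b) by ring.
  apply: (key (size f)); first exact: leq_addl.
  move=> k; case: (ltnP k (size f)) => kf; first by apply: zf; rewrite mem_nth.
  by rewrite nth_default // mulr0; exact: subring0.
have Vg' : poly_over (f * g').
  rewrite -[g']scale1r fg'E scale1r mul1r; apply: poly_overB => // e.
  rewrite coefZ coefMXn; case: ifP => _; first by rewrite mulr0; exact: subring0.
  by rewrite mulrC.
move=> i j; have := IHm _ size_g' Vg' i j; rewrite coef_take_poly.
case: ltngtP => [//|mj _|-> _]; last exact: Vb.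
by rewrite g_big // mulr0; exact: subring0.
Qed.

End PolynomialsOverV.

(** * Greatest common divisors of finite families in K[X] *)

Section CoprimeDecomposition.
Variable K : fieldType.
Implicit Types (N : {poly K} -> Prop) (t : seq {poly K}).

Definition poly_ideal N := [/\ N 0, forall p q, N p -> N q -> N (p + q)
  & forall p q, N q -> N (p * q)].

(* Quantifying over ideals [N] expresses the Bezout identity among the
   cofactors without naming its coefficients. *)
Lemma coprime_decomposition t : has (fun p => p != 0) t ->
  exists g u, [/\ g != 0, t = map ( *%R g) u &
    forall N, poly_ideal N -> (forall p, p \in u -> N p) -> N 1].
Proof.
move=> t0; pose g := foldr (@gcdp K) 0 t.
have gdvd p : p \in t -> g %| p.
  rewrite /g; elim: t {t0 g} => //= q t IHt; rewrite inE => /orP[/eqP-> | pt].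
    exact: dvdp_gcdl.
  exact: dvdp_trans (dvdp_gcdr _ _) (IHt pt).
have gN N : poly_ideal N -> (forall p, p \in t -> N p) -> N g.
  case=> N0 ND NM; rewrite /g; elim: t {t0 g gdvd} => //= q t IHt Nt.
  have [u /eqpP[[c1 c2] /= /andP[c10 c20] e]] := Bezoutp q (foldr (@gcdp K) 0 t).
  set d := foldr _ _ t in u e *.
  (* The Bezout combination equals the gcd only up to a nonzero constant, absorbed here. *)
  have -> : gcdp q d = (c2^-1 * c1)%:P * (u.1 * q + u.2 * d).
    by rewrite mul_polyC -scalerA e scalerA mulVf // scale1r.
  apply: (NM); apply: ND; apply: NM; first by apply: Nt; rewrite mem_head.
  by apply: IHt => p pt; apply: Nt; rewrite inE pt orbT.
have g0 : g != 0.
  have [p pt p0] := hasP t0; apply: contraNneq p0 => g0.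
  by have := gdvd p pt; rewrite g0 dvd0p.
exists g, (map (fun p => p %/ g) t); split=> //.
  by rewrite -map_comp -[LHS]map_id; apply/eq_in_map => p /gdvd/divpK /= pE; rewrite mulrC.
move=> N [N0 ND NM] Nu.
(* The ideal N g contains [t], hence [g]; cancelling [g] puts 1 in N. *)
have [||q gE Nq] := gN (fun p => exists2 q, p = q * g & N q).
- split.
  + by exists 0; rewrite ?mul0r.
  + move=> _ _ [p -> Np] [q -> Nq]; exists (p + q); first by rewrite mulrDl.
    exact: ND.
  by move=> p _ [q -> Nq]; exists (p * q); [rewrite mulrA | exact: NM].
- move=> p pt; exists (p %/ g); first by rewrite divpK // gdvd.
  by apply: Nu; apply/mapP; exists p.
by rewrite -(mulIf g0 (etrans (mul1r g) gE)) in Nq.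
Qed.

End CoprimeDecomposition.

(** * Transfer of the colon criterion between V and V[X]_S *)

Section PolynomialLocalization.
Variables (K L : fieldType) (V : K -> Prop) (psi : {rmorphism {poly K} -> L}).
Variable S : {poly K} -> Prop.
Implicit Types p q s : {poly K}.

(** This is V[X]_S inside L, with [psi] embedding K[X] in L. Keeping L abstract allows it to be the
    fraction field of D[X] rather than that of K[X]. *)
Definition poly_localize (x : L) :=
  exists p s, [/\ poly_over V p, S s & x = psi p / psi s].

Hypothesis Vring : subring V.
Hypothesis Vfrac : has_fraction_field V.
Hypothesis psi_inj : injective psi.
Hypothesis psi_frac : forall x, exists p q, q != 0 /\ x = psi p / psi q.
Hypothesis S1 : S 1.
Hypothesis SM : forall s s', S s -> S s' -> S (s * s').
Hypothesis S_over : forall s, S s -> poly_over V s.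
Hypothesis S_content : forall s, S s -> exists i u, V u /\ s`_i * u = 1.

Lemma psi_neq0 p : p != 0 -> psi p != 0.
Proof. by rewrite -(rmorph0 psi) (inj_eq psi_inj). Qed.

Lemma loc_set_neq0 s : S s -> s != 0.
Proof.
move=> /S_content[i [u [_ e]]]; apply/eqP => s0.
by move/eqP: e; rewrite s0 coef0 mul0r eq_sym oner_eq0.
Qed.

Lemma loc_set_psi_neq0 s : S s -> psi s != 0.
Proof. by move=> /loc_set_neq0/psi_neq0. Qed.

(** Over a common denominator d the elements become polynomials; their gcd divided by d is the
    common factor. *)
Lemma fractional_coprime_decomposition (t : seq L) : has (fun a => a != 0) t ->
  exists g u, [/\ g != 0, t = [seq g * psi p | p <- u] &
    forall N, poly_ideal N -> (forall p, p \in u -> N p) -> N 1].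
Proof.
move=> t0.
have [d [t' [d0 tE]]] : exists d t', d != 0 /\ t = [seq psi p / psi d | p <- t'].
  elim: t {t0} => [|a t [d [t' [d0 ->]]]]; first by exists 1, [::]; rewrite oner_eq0.
  have [p [q [q0 ->]]] := psi_frac a.
  exists (d * q), (p * d :: [seq r * q | r <- t']); split; first by rewrite mulf_neq0.
  have [qn0 dn0] := (psi_neq0 q0, psi_neq0 d0).
  rewrite /= -map_comp; congr (_ :: _).
    by rewrite !rmorphM [psi d * _]mulrC -mulf_div divff // mulr1.
  by apply: eq_map => r /=; rewrite !rmorphM -mulf_div divff // mulr1.
have t'0 : has (fun p => p != 0) t'.
  have [a] := hasP t0; rewrite tE => /mapP[p pt ->] a0; apply/hasP; exists p => //.
  by apply: contraNneq a0 => ->; rewrite rmorph0 mul0r.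
have [g [u [g0 t'E uN]]] := coprime_decomposition t'0.
exists (psi g / psi d), u; split=> //.
  by rewrite mulf_neq0 ?invr_eq0 ?psi_neq0.
rewrite tE t'E -map_comp; apply: eq_map => p /=.
by rewrite rmorphM mulrAC.
Qed.

(* With h coprime, the generators are g h_i; testing the colon condition on
   z = c / g, for constants c with c h_i in V[X], suffices: coprimality gives
   x = b / s with b in K[X], and Gauss's lemma brings the condition down to
   the coefficients of b. *)
Lemma inv_colon_trivial_localize :
  inv_colon_trivial V -> inv_colon_trivial poly_localize.
Proof.
move=> critV t t0 x xt.
have [g [u [g0 tE uN]]] := fractional_coprime_decomposition t0.
(* [J] generates the joint content ideal of the cofactors. *)
pose J := flatten (map (@polyseq K) u).
have JP c p : (forall a, a \in J -> V (c * a)) -> p \in u -> poly_over V (c *: p).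
  move=> cJ pu i; rewrite coefZ; case: (ltnP i (size p)) => ip; last first.
    by rewrite nth_default // mulr0; apply: subring0.
  by apply: cJ; apply/flatten_mapP; exists p; rewrite ?mem_nth.
have xJ c p : (forall a, a \in J -> V (c * a)) -> p \in u ->
    poly_localize (x * psi (c *: p)).
  move=> cJ pu.
  have -> : psi (c *: p) = (psi c%:P / g) * (g * psi p).
    by rewrite -mul_polyC rmorphM mulrA divfK.
  rewrite mulrA; apply: xt; last by rewrite tE; apply/mapP; exists p.
  move=> a; rewrite tE => /mapP[q qu ->]; rewrite mulrA divfK // -rmorphM mul_polyC.
  by exists (c *: q), 1; rewrite rmorph1 divr1; split=> //; apply: JP.
have [c0 [c00 _ c0J]] := common_denominator Vring J Vfrac.
have [s Ss [b xE]] : exists2 s, S s & exists b, x = psi b / psi s.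
  (* [N] is the ideal of the p with x p in K[X]_S. It contains each cofactor by the test with the
     constant c0, which is then divided out in K. *)
  pose N p := exists2 s, S s & exists b, x * psi p = psi b / psi s.
  suff [s Ss [b xE]] : N 1 by exists s => //; exists b; rewrite -xE rmorph1 mulr1.
  apply: uN.
    split.
    - by exists 1 => //; exists 0; rewrite !rmorph0 mulr0 mul0r.
    - move=> p q [s Ss [b e]] [s' Ss' [b' e']]; exists (s * s'); first exact: SM.
      exists (b * s' + b' * s); rewrite rmorphD mulrDr e e' addf_div ?loc_set_psi_neq0 //.
      by rewrite rmorphD !rmorphM.
    move=> p q [s Ss [b e]]; exists s => //; exists (p * b).
    by rewrite !rmorphM mulrCA e mulrA.
  move=> p /(xJ c0 p c0J)[b [s [_ Ss e]]]; exists s => //; exists (c0^-1 *: b).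
  rewrite -mul_polyC rmorphM -mulrA -e mulrCA -rmorphM mul_polyC scalerA mulVf //.
  by rewrite scale1r.
(* Each coefficient of b is tested against [J]. If [J] had no nonzero element, all cofactors would
   vanish and the zero ideal would contain 1. *)
exists b, s; split=> // l; apply: (critV J).
  have [//|Jn] := boolP (has (fun a => a != 0) J).
  have /eqP : 1 = 0 :> {poly K}; last by rewrite oner_eq0.
  apply: (uN (fun p => p = 0)).
    by split=> // [p q -> ->|p q ->]; rewrite ?addr0 ?mulr0.
  move=> p pu; apply/eqP; apply: contraNT Jn => p0; apply/hasP.
  exists (lead_coef p); last by rewrite lead_coef_eq0.
  apply/flatten_mapP; exists p => //.
  by rewrite lead_coefE mem_nth // prednK // size_poly_gt0.
move=> c cJ a /flatten_mapP[p pu /(nthP 0)[k kp <-]].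
have p0 : p != 0 by rewrite -size_poly_gt0; apply: leq_ltn_trans kp.
have [b' [s' [b'V Ss' e]]] := xJ c p cJ pu.
have bE : s' * (b * (c *: p)) = s * b'.
  apply: psi_inj; rewrite !rmorphM; move: e; rewrite xE => e.
  apply: (mulfI (invr_neq0 (loc_set_psi_neq0 Ss))).
  rewrite [RHS]mulKf ?loc_set_psi_neq0 //.
  rewrite -[RHS](divfK (loc_set_psi_neq0 Ss')) -e; ring.
(* Gauss's lemma for s' and b c p, read at a unit coefficient of s', eliminates s'. A second use,
   for p and c b, separates the coefficients. *)
have bcp : poly_over V (p * (c *: b)).
  move=> i; have [m [v [Vv sv]]] := S_content Ss'.
  have := gauss_lemma Vring critV (loc_set_neq0 Ss') _ m i.
  move/(_ (b * (c *: p))); rewrite bE => /(_ (poly_overM Vring (S_over Ss) b'V)).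
  move=> /(subringM Vring Vv); rewrite mulrA [v * _]mulrC sv mul1r.
  by rewrite -scalerAr [b * p]mulrC -scalerAr.
have := gauss_lemma Vring critV p0 bcp k l; rewrite coefZ; congr V; ring.
Qed.

Hypothesis S_const : forall s, S s -> exists u, V u /\ s`_0 * u = 1.

(** Compare constant terms in c s = p and divide by the unit s_0. *)
Lemma poly_localize_const c : poly_localize (psi c%:P) -> V c.
Proof.
move=> [p [s [Vp Ss e]]]; have [u [Vu su]] := S_const Ss.
have : psi (c%:P * s) = psi p by rewrite rmorphM e divfK ?loc_set_psi_neq0.
move/psi_inj/(congr1 (coefp 0)); rewrite /= coefCM => e0.
by rewrite -[c]mulr1 -su mulrA e0; apply: subringM.
Qed.

(** An element z of the inverse of I V[X]_S has the form y / s with the coefficients of y in I^-1,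
    so the colon condition on x passes to V[X]_S coefficient by coefficient. *)
Lemma inv_colon_trivial_const :
  inv_colon_trivial poly_localize -> inv_colon_trivial V.
Proof.
move=> critR t t0 x xt; apply: poly_localize_const.
apply: (critR [seq psi a%:P | a <- t]).
  have [a at_ a0] := hasP t0; apply/hasP; exists (psi a%:P); first exact: map_f.
  by rewrite psi_neq0 // polyC_eq0.
move=> z zt.
have [a0 a0t a00] := hasP t0.
have psiC0 : psi a0%:P != 0 by rewrite psi_neq0 // polyC_eq0.
have [s Ss zs] : exists2 s, S s & forall a, a \in t ->
    exists2 p, poly_over V p & z * psi a%:P = psi p / psi s.
  elim: t zt {t0 xt a0t} => [_|a t IHt zt]; first by exists 1.
  have [|s Ss zs] := IHt; first by move=> y yt; apply: zt; rewrite inE yt orbT.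
  have [p [s' [Vp Ss' e]]] := zt _ (mem_head _ _).
  exists (s * s'); first exact: SM.
  move=> b; rewrite inE => /orP[/eqP -> | /zs[q Vq ->]].
    exists (s * p); first by apply: poly_overM => //; apply: S_over.
    by rewrite e !rmorphM -mulf_div divff ?mul1r ?loc_set_psi_neq0.
  exists (q * s'); first by apply: poly_overM => //; apply: S_over.
  by rewrite !rmorphM -mulf_div divff ?mulr1 ?loc_set_psi_neq0.
have [p0 _ e0] := zs a0 a0t.
(* The numerator of z is read off from one nonzero generator: z a0 = p0 / s. *)
pose y := a0^-1 *: p0.
have zE : z = psi y / psi s.
  rewrite /y -mul_polyC rmorphM -mulrA -e0 mulrCA -rmorphM -polyCM mulVf //.
  by rewrite rmorph1 mulr1.
have yV a l : a \in t -> V (y`_l * a).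
  move=> /zs[p Vp]; rewrite zE mulrAC => /(mulIf (invr_neq0 (loc_set_psi_neq0 Ss))).
  rewrite -rmorphM => /psi_inj pE; have := Vp l.
  by rewrite -pE mulrC coefCM mulrC.
move=> _ /mapP[a at_ ->]; exists (x%:P * y * a%:P), s; split=> //.
  by move=> l; rewrite mulrC coefCM coefCM mulrC; apply: xt => // b bt; apply: yV.
by rewrite zE !rmorphM; ring.
Qed.

End PolynomialLocalization.

(** * Localization at a prime and clearing of denominators *)

Lemma div_cancel_mull (F : fieldType) (a b c : F) : c != 0 ->
  a / b = (c * b)^-1 * (c * a).
Proof. by move=> c0; rewrite invfM mulrACA mulVf // mul1r mulrC. Qed.

Section Localization.
Variables (K : fieldType) (E P : K -> Prop).
Hypotheses (Ering : subring E) (Eprime : is_prime_ideal E P).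

Lemma primeM_notin x y : E x -> E y -> ~ P x -> ~ P y -> ~ P (x * y).
Proof. by move=> Ex Ey nPx nPy; case: Eprime => _ [_ [_ [_ [_ PM]]]] /(PM _ _ Ex Ey)[]. Qed.

Lemma notin_prime_neq0 x : ~ P x -> x != 0.
Proof. by case: Eprime => _ [P0 _] nPx; apply/eqP => x0; apply: nPx; rewrite x0. Qed.

Lemma localize_incl x : E x -> localize E P x.
Proof.
case: Eprime => _ [_ [_ [_ [nP1 _]]]] Ex.
by exists x, 1; rewrite divr1; split=> //; split=> //; exact: subring1.
Qed.

Lemma localize_subring : subring (localize E P).
Proof.
split.
- by apply: localize_incl; exact: subring1.
- move=> _ _ [a [b [Ea [Eb [nPb ->]]]]] [a' [b' [Ea' [Eb' [nPb' ->]]]]].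
  exists (a * b' - a' * b), (b * b'); do !split.
  + by apply: subringB => //; apply: subringM.
  + exact: subringM.
  + exact: primeM_notin.
  by rewrite -mulNr addf_div ?notin_prime_neq0 // mulNr.
- move=> _ _ [a [b [Ea [Eb [nPb ->]]]]] [a' [b' [Ea' [Eb' [nPb' ->]]]]].
  exists (a * a'), (b * b'); do !split; rewrite ?mulf_div //; try exact: subringM.
  exact: primeM_notin.
Qed.

Lemma localize_fraction_field : has_fraction_field E ->
  has_fraction_field (localize E P).
Proof.
by move=> fracE x; have [d [d0 Ed Edx]] := fracE x; exists d; split=> //; exact: localize_incl.
Qed.

End Localization.

(** The set C of admissible denominators is abstract so as to serve both for the nonzero elements of
    D and for the complement of a prime. *)
Lemma poly_clear_denominators (D : idomainType) (F : fieldType)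
    (h : {rmorphism D -> F}) (C : D -> Prop) (p : {poly F}) :
  C 1 -> (forall c d, C c -> C d -> C (c * d)) ->
  (forall i, exists n d, C d /\ h d * p`_i = h n) ->
  exists c f, C c /\ (h c)%:P * p = map_poly h f.
Proof.
move=> C1 CM; elim/poly_ind: p => [_ | p a IHp Cp].
  by exists 1, 0; rewrite mulr0 rmorph0.
have [i|c [f [Cc e]]] := IHp.
  by have := Cp i.+1; rewrite coefD coefMX coefC /= addr0.
have := Cp 0%N; rewrite coefD coefMX coefC /= add0r => -[n [d [Cd aE]]].
exists (c * d), (f * d%:P * 'X + (c * n)%:P); split; first exact: CM.
rewrite rmorphD !rmorphM /= map_polyX !map_polyC /= -e -aE; ring.
Qed.

(** * D and D[X]_A inside their fraction fields *)

Section AndersonRing.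
Variable D : idomainType.

Lemma base_ring_subring : subring (@base_ring D).
Proof.
split; first by exists 1; rewrite tofrac1.
  by move=> _ _ [a ->] [b ->]; exists (a - b); rewrite tofracB.
by move=> _ _ [a ->] [b ->]; exists (a * b); rewrite tofracM.
Qed.

Lemma base_ring_fraction_field : has_fraction_field (@base_ring D).
Proof.
move=> x; have [n [d [d0 ->]]] := fraction_ratio x.
have td : tofrac d != 0 by rewrite tofrac_eq0.
exists (tofrac d); split=> //; first by exists d.
by exists n; rewrite mulrC divfK.
Qed.

Lemma horner0_eq1_neq0 (g : {poly D}) : g.[0] = 1 -> tofrac g != 0.
Proof.
by rewrite tofrac_eq0; move=> g1; apply: contra_eq_neq g1 => ->; rewrite horner0 eq_sym oner_eq0.
Qed.

Lemma polyA_loc_poly (f : {poly D}) : polyA_loc (tofrac f).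
Proof. by exists f, 1; rewrite hornerC tofrac1 divr1. Qed.

Lemma polyA_loc_subring : subring (@polyA_loc D).
Proof.
split; first by rewrite -tofrac1; exact: polyA_loc_poly.
  move=> _ _ [f [g [g1 ->]]] [f' [g' [g'1 ->]]].
  exists (f * g' - f' * g), (g * g'); rewrite hornerM g1 g'1 mulr1; split=> //.
  by rewrite tofracB !tofracM -mulNr addf_div ?horner0_eq1_neq0 // mulNr.
move=> _ _ [f [g [g1 ->]]] [f' [g' [g'1 ->]]].
exists (f * f'), (g * g'); rewrite hornerM g1 g'1 mulr1; split=> //.
by rewrite !tofracM mulf_div.
Qed.

Lemma polyA_loc_fraction_field : has_fraction_field (@polyA_loc D).
Proof.
move=> x; have [n [d [d0 ->]]] := fraction_ratio x.
have td : tofrac d != 0 by rewrite tofrac_eq0.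
exists (tofrac d); split=> //; first exact: polyA_loc_poly.
by rewrite mulrC divfK //; exact: polyA_loc_poly.
Qed.

(** The map from D to Frac(D[X]) extends to Frac(D), then to polynomials by sending X to X. Clearing
    denominators reduces injectivity to D[X]. *)
Lemma fraction_poly_embedding :
  exists psi : {rmorphism {poly {fraction D}} -> {fraction {poly D}}},
  [/\ injective psi,
      forall f, psi (map_poly (@tofrac D) f) = tofrac f &
      forall x, exists p q, q != 0 /\ x = psi p / psi q].
Proof.
have [|g gE] := @fraction_lift D _
  [the {rmorphism D -> {fraction {poly D}}} of @tofrac {poly D} \o @polyC D].
  by move=> a b /eqP; rewrite /= tofrac_eq (inj_eq (@polyC_inj _)) => /eqP.
have cfu : commr_rmorph g (tofrac 'X) by move=> a; apply: mulrC.
pose psi : {rmorphism {poly {fraction D}} -> {fraction {poly D}}} :=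
  horner_morph cfu.
have psiE f : psi (map_poly (@tofrac D) f) = tofrac f.
  elim/poly_ind: f => [|f c e]; first by rewrite !rmorph0.
  rewrite rmorphD rmorphM /= map_polyX map_polyC /= rmorphD rmorphM e.
  rewrite /psi /= horner_morphX horner_morphC /= gE /=.
  by rewrite rmorphD rmorphM.
have clear p : exists c f, c != 0 /\ (tofrac c)%:P * p = map_poly (@tofrac D) f.
  apply: (poly_clear_denominators (C := fun c => c != 0)).
  - exact: oner_neq0.
  - by move=> c d c0 d0; rewrite mulf_neq0.
  move=> i; have [n [d [d0 ->]]] := fraction_ratio p`_i.
  by exists n, d; split=> //; rewrite mulrC divfK ?tofrac_eq0.
exists psi; split=> //.
- apply: raddf_inj => p p0; have [c [f [c0 e]]] := clear p.
  have : psi ((tofrac c)%:P * p) = 0 by rewrite rmorphM p0 mulr0.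
  rewrite e psiE => /eqP; rewrite tofrac_eq0 => /eqP f0.
  move/eqP: e; rewrite f0 rmorph0 mulf_eq0 polyC_eq0 tofrac_eq0 (negPf c0) /=.
  by move/eqP.
move=> x; have [n [d [d0 ->]]] := fraction_ratio x.
exists (map_poly (@tofrac D) n), (map_poly (@tofrac D) d); rewrite !psiE; split=> //.
by rewrite map_poly_eq0_id0 // ?tofrac_eq0 // lead_coef_eq0.
Qed.

(** * The localization at Q compared with the one at the prime P below it *)

Section LyingOver.
Variables (P : {fraction D} -> Prop) (Q : {fraction {poly D}} -> Prop).
Hypothesis Pprime : is_prime_ideal (@base_ring D) P.
Hypothesis Qprime : is_prime_ideal (@polyA_loc D) Q.
Hypothesis PQ : forall d : D, P (tofrac d) <-> Q (tofrac d%:P).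

Let V := localize (@base_ring D) P.

Definition prime_complement (s : {poly {fraction D}}) :=
  exists2 q : {poly D}, s = map_poly (@tofrac D) q & ~ Q (tofrac q).

(** If all coefficients lay in P, every monomial of q, and hence q, would lie in Q. *)
Lemma notin_Q_coef (q : {poly D}) : ~ Q (tofrac q) -> exists i, ~ P (tofrac q`_i).
Proof.
move=> nQq; apply: NNPP => nP; apply: nQq.
have [_ [Q0 [QD [QM _]]]] := Qprime.
rewrite -[q]coefK poly_def rmorph_sum /=; elim/big_ind: _ => // i _.
rewrite -mul_polyC tofracM mulrC; apply: QM; first exact: polyA_loc_poly.
by apply/PQ; apply: NNPP => nPi; apply: nP; exists i.
Qed.

Lemma poly_over_clear p : poly_over V p ->
  exists c f, ~ P (tofrac c) /\ (tofrac c)%:P * p = map_poly (@tofrac D) f.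
Proof.
have [_ [_ [_ [_ [nP1 _]]]]] := Pprime.
move=> Vp; apply: (poly_clear_denominators (C := fun c => ~ P (tofrac c))).
- by rewrite tofrac1.
- move=> c d nPc nPd; rewrite tofracM; apply: (primeM_notin Pprime) => //.
    by exists c.
  by exists d.
move=> i; have [_ [_ [[n ->] [[d ->] [nPd ->]]]]] := Vp i.
by exists n, d; split=> //; rewrite mulrC divfK // (notin_prime_neq0 Pprime).
Qed.

(** Elements of A are units of D[X]_A, so they can be absorbed into S; conversely, denominators of
    coefficients in V are constants outside Q. *)
Lemma localize_polyA_locP
    (psi : {rmorphism {poly {fraction D}} -> {fraction {poly D}}}) x :
  (forall f, psi (map_poly (@tofrac D) f) = tofrac f) ->
  localize (@polyA_loc D) Q x <-> poly_localize V psi prime_complement x.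
Proof.
move=> psiE; have [_ [_ [_ [QM _]]]] := Qprime.
have nP1 : ~ P 1 by have [_ [_ [_ [_ []]]]] := Pprime.
have over f : poly_over V (map_poly (@tofrac D) f).
  by move=> i; rewrite coef_map; apply: localize_incl => //; [exact: base_ring_subring | exists f`_i].
split=> [[_ [_ [[f [g [g1 ->]]] [[f' [g' [g'1 ->]]] [nQ ->]]]]] | ].
  have [gn0 g'n0] := (horner0_eq1_neq0 g1, horner0_eq1_neq0 g'1).
  exists (map_poly (@tofrac D) (f * g')), (map_poly (@tofrac D) (g * f')).
  rewrite !psiE; split=> //; last by rewrite invf_div mulf_div -!tofracM.
  exists (g * f') => // Qgf'; apply: nQ.
  (* f'/g' is g f' times 1/(g g'), and g g' has constant term 1. *)
  rewrite (div_cancel_mull _ _ gn0) -!tofracM; apply: QM => //.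
  exists 1, (g * g'); rewrite hornerM g1 g'1 mulr1; split=> //.
  by rewrite tofrac1 div1r.
move=> [p [_ [Vp [q -> nQq] ->]]].
have [c [f [nPc e]]] := poly_over_clear Vp.
have nQc : ~ Q (tofrac c%:P) by move/PQ.
exists (tofrac f), (tofrac (c%:P * q)); do !split; try exact: polyA_loc_poly.
  rewrite tofracM; apply: (primeM_notin Qprime) => //; exact: polyA_loc_poly.
have c0 : tofrac c%:P != 0 := notin_prime_neq0 Qprime nQc.
rewrite psiE -(psiE f) -e rmorphM -map_polyC psiE tofracM -mulf_div divff // mul1r //.
Qed.

Lemma prime_complement1 : prime_complement 1.
Proof.
exists 1; first by rewrite rmorph1.
by rewrite tofrac1; have [_ [_ [_ [_ []]]]] := Qprime.
Qed.

Lemma prime_complementM s s' :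
  prime_complement s -> prime_complement s' -> prime_complement (s * s').
Proof.
move=> [q -> nQq] [q' -> nQq']; exists (q * q'); first by rewrite rmorphM.
by rewrite tofracM; apply: (primeM_notin Qprime) => //; exact: polyA_loc_poly.
Qed.

Lemma prime_complement_over s : prime_complement s -> poly_over V s.
Proof.
move=> [q -> _] i; rewrite coef_map; apply: (localize_incl base_ring_subring Pprime).
by exists q`_i.
Qed.

Lemma localize_base_unit (d : D) : ~ P (tofrac d) ->
  exists u, V u /\ tofrac d * u = 1.
Proof.
move=> nPd; exists (tofrac d)^-1; rewrite divff; last exact: (notin_prime_neq0 Pprime).
split=> //; exists 1, (tofrac d); rewrite div1r; do !split=> //; last by exists d.
by exists 1; rewrite tofrac1.
Qed.

Lemma prime_complement_content s : prime_complement s ->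
  exists i u, V u /\ s`_i * u = 1.
Proof.
by move=> [q -> /notin_Q_coef[i /localize_base_unit]]; exists i; rewrite coef_map.
Qed.

Let Vring : subring V := localize_subring base_ring_subring Pprime.
Let Vfrac : has_fraction_field V :=
  localize_fraction_field base_ring_subring Pprime base_ring_fraction_field.

Lemma is_v_domain_polyA_loc_iff
    (psi : {rmorphism {poly {fraction D}} -> {fraction {poly D}}}) :
  (forall f, psi (map_poly (@tofrac D) f) = tofrac f) ->
  is_v_domain (localize (@polyA_loc D) Q) <->
  inv_colon_trivial (poly_localize V psi prime_complement).
Proof.
move=> psiE; have RP x := localize_polyA_locP x psiE.
apply: (iff_trans (is_v_domain_iff
  (localize_subring polyA_loc_subring Qprime)
  (localize_fraction_field polyA_loc_subring Qprime polyA_loc_fraction_field))).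
by split=> crit s s0 x xs; apply/RP; apply: crit s0 _ _ => z zs a as_;
  apply/RP; apply: xs => // b bs; apply/RP; apply: zs.
Qed.

Lemma is_v_domain_lying_over :
  is_v_domain V -> is_v_domain (localize (@polyA_loc D) Q).
Proof.
move=> /(is_v_domain_iff Vring Vfrac) critV.
have [psi [psi_inj psiE psi_frac]] := fraction_poly_embedding.
apply/(is_v_domain_polyA_loc_iff psiE).
by apply: inv_colon_trivial_localize => //;
  [exact: prime_complement1 | exact: prime_complementM
  | exact: prime_complement_over | exact: prime_complement_content].
Qed.

Lemma is_v_domain_contraction :
  (forall q : {poly D}, ~ Q (tofrac q) -> ~ P (tofrac q`_0)) ->
  is_v_domain (localize (@polyA_loc D) Q) -> is_v_domain V.
Proof.
have [psi [psi_inj psiE psi_frac]] := fraction_poly_embedding.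
move=> Q0 /(is_v_domain_polyA_loc_iff psiE) critR.
apply/(is_v_domain_iff Vring Vfrac); apply: inv_colon_trivial_const critR => //.
- exact: prime_complement1.
- exact: prime_complementM.
- exact: prime_complement_over.
- exact: prime_complement_content.
by move=> s [q -> /Q0/localize_base_unit]; rewrite coef_map.
Qed.

End LyingOver.

(** * Contraction and extension of primes between D and D[X]_A *)

Lemma contraction_prime Q : is_prime_ideal (@polyA_loc D) Q ->
  is_prime_ideal (@base_ring D) (fun x => exists2 d, x = tofrac d & Q (tofrac d%:P)).
Proof.
move=> [_ [Q0 [QD [QM [nQ1 Qprime]]]]]; do !split.
- by move=> _ [d -> _]; exists d.
- by exists 0; rewrite ?tofrac0.
- move=> _ _ [a -> Qa] [b -> Qb]; exists (a + b); first by rewrite tofracD.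
  by rewrite polyCD tofracD; apply: QD.
- move=> _ _ [a ->] [b -> Qb]; exists (a * b); first by rewrite tofracM.
  by rewrite polyCM tofracM; apply: QM => //; exact: polyA_loc_poly.
- by move=> [d /eqP]; rewrite -tofrac1 tofrac_eq => /eqP <-; rewrite tofrac1.
move=> _ _ [a ->] [b ->] [d /eqP]; rewrite -tofracM tofrac_eq => /eqP <-.
rewrite polyCM tofracM => /Qprime[||Qa|Qb]; try exact: polyA_loc_poly.
  by left; exists a.
by right; exists b.
Qed.

(** The preimage of P under evaluation at 0 on D[X]_A; for P prime, the extension of P + X D[X]. *)
Definition const_extension (P : {fraction D} -> Prop) (x : {fraction {poly D}}) :=
  exists f g : {poly D}, [/\ g.[0] = 1, P (tofrac f.[0]) & x = tofrac f / tofrac g].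

(** Evaluation at 0 is well defined on D[X]_A: cross-multiply and evaluate, the denominators
    contributing 1. *)
Lemma const_extensionP P f g : g.[0] = 1 ->
  const_extension P (tofrac f / tofrac g) <-> P (tofrac f.[0]).
Proof.
move=> g1; split=> [[f' [g' [g'1 Pf' /eqP]]] | Pf]; last by exists f, g.
rewrite eqr_div ?horner0_eq1_neq0 // -!tofracM tofrac_eq => /eqP/(congr1 (horner^~ 0)).
by rewrite !hornerM g1 g'1 !mulr1 => ->.
Qed.

Lemma const_extension_prime P : is_prime_ideal (@base_ring D) P ->
  is_prime_ideal (@polyA_loc D) (const_extension P).
Proof.
move=> [_ [P0 [PD [PM [nP1 Pprime]]]]]; do !split.
- by move=> _ [f [g [g1 _ ->]]]; exists f, g.
- by exists 0, 1; rewrite hornerC horner0 tofrac0 mul0r.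
- move=> _ _ [f [g [g1 Pf ->]]] [f' [g' [g'1 Pf' ->]]].
  exists (f * g' + f' * g), (g * g').
  rewrite hornerD !hornerM g1 g'1 !mulr1 tofracD; split=> //; first exact: PD.
  by rewrite addf_div ?horner0_eq1_neq0 // tofracD !tofracM.
- move=> _ _ [f [g [g1 ->]]] [f' [g' [g'1 Pf' ->]]].
  exists (f * f'), (g * g'); rewrite !hornerM g1 g'1 mulr1 !tofracM mulf_div.
  by split=> //; apply: PM => //; exists f.[0].
- rewrite -(divr1 1) -tofrac1 => /const_extensionP; rewrite hornerC tofrac1.
  by move=> /(_ erefl).
move=> _ _ [f [g [g1 ->]]] [f' [g' [g'1 ->]]].
rewrite mulf_div -!tofracM => /const_extensionP.
rewrite !hornerM g1 g'1 mulr1 tofracM => /(_ erefl)/Pprime[].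
- by exists f.[0].
- by exists f'.[0].
- by left; exists f, g.
by right; exists f', g'.
Qed.

End AndersonRing.

Theorem mainTheorem20 (D : idomainType) :
  is_locally_v_domain (@polyA_loc D) <-> is_locally_v_domain (@base_ring D).
Proof.
split=> loc_v.
  move=> P Pprime.
  have polyE (f : {poly D}) : P (tofrac f.[0]) <-> const_extension P (tofrac f).
    rewrite -[tofrac f]divr1 -tofrac1; apply: iff_sym; apply: const_extensionP.
    by rewrite hornerC.
  have Qprime := const_extension_prime Pprime.
  apply: (is_v_domain_contraction Pprime Qprime) (loc_v _ Qprime) => [d|q nQ].
    by rewrite -polyE hornerC.
  by rewrite -horner_coef0; move/polyE.
move=> Q Qprime; have Pprime := contraction_prime Qprime.
apply: (is_v_domain_lying_over Pprime Qprime) (loc_v _ Pprime) => d.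
split=> [[e /eqP] | Qd]; last by exists d.
by rewrite tofrac_eq => /eqP <-.
Qed.
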